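(* Let $m\ge 2$ be a natural number and let $P=(p_0,\ldots,p_{2^m-1})\in\mathcal P_m$. Then the function $\varphi_P\colon[0,1]\to[0,1]$ defined by $$\varphi_P(x)=\frac{1}{m}\sum_{i=0}^{m-1}\sum_{k=0}^{2^i-1}\left[\Phi_P\left(\frac{x+k}{2^i}\right)-\Phi_P\left(\frac{k}{2^i}\right)\right]$$ is a solution of the MW-problem. Moreover, if $K_P\neq K$, then $\varphi_P$ is not strictly increasing.
   Context: ''Increasing'' means weakly increasing. A solution of the MW-problem (Matkowski–Wesołowski problem) is any increasing and continuous function $\varphi\colon[0,1]\to[0,1]$ with $\varphi(0)=0$, $\varphi(1)=1$ and $\varphi(x)=\varphi(\frac{x}{2})+\varphi(\frac{x+1}{2})-\varphi(\frac12)$ for every $x\in[0,1]$. For $m\in\mathbb N$ (with $\mathbb N=\{1,2,\ldots\}$), $\mathcal P_m$ is the set of all tuples $(p_0,\ldots,p_{2^m-1})$ with $p_0,\ldots,p_{2^m-1}\in[0,1)$ and $\sum_{k=0}^{2^m-1}p_k=1$. Put $K=\{0,1,\ldots,2^m-1\}$, $f_k\colon[0,1]\to[0,1]$, $f_k(x)=\frac{x+k}{2^m}$ for $k\in K$, and, for $P\in\mathcal P_m$, $K_P=\{k\in K\mid p_k\neq 0\}$. For $P\in\mathcal P_m$, $\mu_P$ denotes the unique (by a theorem of Hutchinson) Borel probability measure on $[0,1]$ satisfying $\mu_P(B)=\sum_{k\in K}p_k\,\mu_P(f_k^{-1}(B))$ for every Borel set $B\subset[0,1]$, and $\Phi_P\colon[0,1]\to[0,1]$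 is its distribution function, $\Phi_P(x)=\mu_P([0,x])$. *)

(* Defs.v *)
From mathcomp Require Import all_boot all_order all_algebra.
From mathcomp Require Import all_classical all_reals all_analysis.

Set Implicit Arguments.
Unset Strict Implicit.
Unset Printing Implicit Defensive.

Import Order.TTheory GRing.Theory Num.Theory.
Import numFieldNormedType.Exports.

Local Open Scope classical_set_scope.
Local Open Scope ring_scope.

(* Functions on [0, 1] are represented by total functions on R, of which only
   the restriction to [0, 1] matters. *)
Definition MW_solution (R : realType) (phi : R -> R) : Prop :=
  [/\ {in `[0, 1], forall x, phi x \in `[0, 1]},
      {in `[0, 1] &, {homo phi : x y / x <= y}} &
      {within `[0, 1], continuous phi}] /\
  [/\ phi 0 = 0, phi 1 = 1 &
      {in `[0, 1], forall x,
        phi x = phi (x / 2) + phi ((x + 1) / 2) - phi (1 / 2)}].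

Definition in_Pm (R : realType) (m : nat) (P : 'I_(2 ^ m)%N -> R) : Prop :=
  (forall k, 0 <= P k < 1) /\ \sum_k P k = 1.

Definition fk (R : realType) (m : nat) (k : 'I_(2 ^ m)%N) (x : R) : R :=
  (x + k%:R) / (2 ^ m)%:R.

Definition KP (R : realType) (m : nat) (P : 'I_(2 ^ m)%N -> R) :
    set 'I_(2 ^ m)%N :=
  [set k | P k != 0].

(* [mu] is the measure [mu_P]: a Borel probability measure on R carried by
   [0, 1], self-similar for the weights [P]. By Hutchinson's theorem these
   conditions determine exactly one measure. The intersection with [0, 1]
   makes the preimage that of the map [f_k] from [0, 1] to [0, 1]. *)
Definition is_muP (R : realType) (m : nat) (P : 'I_(2 ^ m)%N -> R)
    (mu : probability (measurableTypeR R) R) : Prop :=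
  mu `[0, 1]%classic = 1%E /\
  forall B : set (measurableTypeR R), measurable B -> B `<=` `[0, 1]%classic ->
    mu B = (\sum_(k < 2 ^ m) (P k)%:E * mu (`[0%R, 1%R]%classic `&` fk k @^-1` B))%E.

Definition Phi (R : realType) (mu : probability (measurableTypeR R) R)
    (x : R) : R :=
  fine (mu `[0, x]%classic).

Definition varphi (R : realType) (m : nat)
    (mu : probability (measurableTypeR R) R) (x : R) : R :=
  m%:R^-1 * \sum_(i < m) \sum_(k < 2 ^ i)
    (Phi mu ((x + k%:R) / 2 ^+ i) - Phi mu (k%:R / 2 ^+ i)).

(* Main.v *)
(* Put [A_i x = \sum_(k < 2 ^ i) (Phi ((x + k) / 2 ^ i) - Phi (k / 2 ^ i))] and
   [T f x = f (x / 2) + f ((x + 1) / 2) - f (1 / 2)]. Splitting [k] by parity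
   gives [T A_i = A_(i+1)], and the self-similarity of [mu] gives
   [A_m = Phi = A_0], so [T] permutes the [A_i] cyclically and fixes their mean
   [varphi]. Continuity holds because [mu] has no atom.
   If [P k0 = 0], [mu] vanishes on every cell of length [(2 ^ m) ^- (q + 1)]
   whose last base-[2 ^ m] digit is [k0]. A binary word in which [k0] (as a word
   of [m] bits) occurs at positions of every residue mod [m] then defines a cell
   on which all the [A_i], hence [varphi], are constant. *)
Require Import Defs.
From mathcomp Require Import all_boot all_order all_algebra.
From mathcomp Require Import all_classical all_reals all_analysis.
From mathcomp Require Import measurable_realfun zify ring lra.

Set Implicit Arguments.
Unset Strict Implicit.
Unset Printing Implicit Defensive.

Import Order.TTheory GRing.Theory Num.Theory.
Import numFieldNormedType.Exports.

Local Open Scope classical_set_scope.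
Local Open Scope ring_scope.

(** * Dyadic sums of a function on the line *)

Definition dyadic_sum (R : realType) (F : R -> R) (i : nat) (x : R) : R :=
  \sum_(k < 2 ^ i) (F ((x + k%:R) / 2 ^+ i) - F (k%:R / 2 ^+ i)).

Lemma sum_even_odd (V : nmodType) (f : nat -> V) (n : nat) :
  \sum_(k < 2 * n) f k = \sum_(k < n) (f (2 * k)%N + f (2 * k).+1).
Proof.
elim: n => [|n IHn]; first by rewrite muln0 !big_ord0.
by rewrite mulnS addnC addn2 !big_ord_recr /= IHn addrA.
Qed.

(** Even and odd indices give the points [(x / 2 + k) / 2 ^ i] and [((x + 1) / 2 + k) / 2 ^ i]. The
    first two sums on the right subtract [F (k / 2 ^ i)] twice; the third trades one copy for
    [F ((1 / 2 + k) / 2 ^ i)], the constant of the odd index. *)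
Lemma dyadic_sumS (R : realType) (F : R -> R) (i : nat) (x : R) :
  dyadic_sum F i.+1 x =
  dyadic_sum F i (x / 2) + dyadic_sum F i ((x + 1) / 2)
  - dyadic_sum F i (1 / 2).
Proof.
rewrite /dyadic_sum expnS (sum_even_odd (fun k =>
  F ((x + k%:R) / 2 ^+ i.+1) - F (k%:R / 2 ^+ i.+1))).
rewrite -big_split -sumrB /=; apply: eq_bigr => k _.
have h2 : (2 : R) ^+ i != 0 by rewrite expf_neq0 // pnatr_eq0.
rewrite -[(2 * k).+1%:R]natr1 natrM exprS.
have -> : (x + 2 * k%:R) / (2 * 2 ^+ i) = (x / 2 + k%:R) / 2 ^+ i by field.
have -> : (x + (2 * k%:R + 1)) / (2 * 2 ^+ i) = ((x + 1) / 2 + k%:R) / 2 ^+ i.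
  by field.
have -> : (2 * k%:R + 1) / (2 * 2 ^+ i) = (1 / 2 + k%:R) / 2 ^+ i :> R by field.
have -> : 2 * k%:R / (2 * 2 ^+ i) = k%:R / 2 ^+ i :> R by field.
by ring.
Qed.

Lemma dyadic_sum_at0 (R : realType) (F : R -> R) (i : nat) :
  dyadic_sum F i 0 = 0.
Proof. by rewrite /dyadic_sum big1 // => k _; rewrite add0r subrr. Qed.

Lemma dyadic_sum_at1 (R : realType) (F : R -> R) (i : nat) :
  dyadic_sum F i 1 = F 1 - F 0.
Proof.
have h2 : (2 : R) ^+ i != 0 by rewrite expf_neq0 // pnatr_eq0.
have := telescope_sumr (fun k : nat => F (k%:R / 2 ^+ i)) (leq0n (2 ^ i)).
rewrite natrX divff // mul0r => <-.
by rewrite big_mkord; apply: eq_bigr => k _; rewrite nat1r.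
Qed.

Lemma dyadic_sum0 (R : realType) (F : R -> R) (x : R) :
  F 0 = 0 -> dyadic_sum F 0 x = F x.
Proof.
by move=> F0; rewrite /dyadic_sum expn0 big_ord1 expr0 !divr1 addr0 F0 subr0.
Qed.

Lemma dyadic_sum_homo (R : realType) (F : R -> R) (i : nat) :
  {homo F : x y / x <= y} -> {homo dyadic_sum F i : x y / x <= y}.
Proof.
move=> Fle x y xy; apply: ler_sum => k _; rewrite lerD2r; apply: Fle.
by rewrite ler_pM2r ?invr_gt0 ?exprn_gt0 // lerD2r.
Qed.

Lemma continuous_dyadic_sum (R : realType) (F : R -> R) (i : nat) :
  continuous F -> continuous (dyadic_sum F i).
Proof.
move=> cF; apply: continuous_big => [|k _ x]; first exact: add_continuous.
apply: cvgB; last exact: cvg_cst.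
have cg : continuous (fun y : R => (y + k%:R) / 2 ^+ i).
  by move=> y; apply: cvgMr_tmp; apply: cvgD; [exact: cvg_id|exact: cvg_cst].
exact: (continuous_comp (cg x) (cF _)).
Qed.

(** * Self-similar distribution functions *)

(** The values 0 and 1 beyond the unit interval let the functional equation hold on the whole line,
    with no clipping of [2 ^ m * x - k]. *)
Definition self_similar_cdf (R : realType) (m : nat) (P : 'I_(2 ^ m)%N -> R)
    (F : R -> R) : Prop :=
  [/\ forall x, x <= 0 -> F x = 0, forall x, 1 <= x -> F x = 1,
      {homo F : x y / x <= y} &
      forall x, F x = \sum_k P k * F ((2 ^ m)%:R * x - k%:R)].

(** Self-similarity turns the sum into a double sum of [P j * (F (x + k - j) - F (k - j))]. For
    [k != j] both arguments lie on the same side of the open unit interval, so only the diagonal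
    [P j * F x] survives. *)
Lemma dyadic_sum_period (R : realType) (m : nat) (P : 'I_(2 ^ m)%N -> R)
    (F : R -> R) (x : R) :
  self_similar_cdf P F -> x \in `[0, 1] -> dyadic_sum F m x = F x.
Proof.
move=> [F0 F1 _ FE]; rewrite in_itv /= => /andP[x0 x1].
have h2 : (2 : R) ^+ m != 0 by rewrite expf_neq0 // pnatr_eq0.
have Fint y (k : nat) : F ((y + k%:R) / 2 ^+ m) = \sum_j P j * F (y + k%:R - j%:R).
  by rewrite FE; apply: eq_bigr => j _; rewrite natrX [2 ^+ m * _]mulrC divfK.
(* This is the functional equation at 1, where all arguments [2 ^ m - k] are at least 1. *)
have Psum : \sum_k P k = 1.
  rewrite -[RHS](F1 1) // FE; apply: eq_bigr => k _; rewrite F1 ?mulr1 //.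
  by rewrite lerBrDr addrC natr1 ler_nat.
rewrite -[RHS]mul1r -Psum mulr_suml /dyadic_sum.
transitivity (\sum_(k < 2 ^ m) \sum_j P j * (F (x + k%:R - j%:R) - F (k%:R - j%:R))).
  apply: eq_bigr => k _; have := Fint 0 k; rewrite add0r Fint => ->.
  by rewrite -sumrB; apply: eq_bigr => j _; rewrite mulrBr.
rewrite exchange_big; apply: eq_bigr => j _ /=.
rewrite (bigD1 j) //= big1 ?addr0 => [|k kj].
  by rewrite addrK subrr (F0 0) // subr0.
have [kj'|jk] := ltnP k j.
  have : k.+1%:R <= j%:R :> R by rewrite ler_nat.
  by rewrite -natr1 => ?; rewrite !F0 ?subrr ?mulr0 //; lra.
have : j.+1%:R <= k%:R :> R by rewrite ler_nat ltn_neqAle jk eq_sym kj.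
by rewrite -natr1 => ?; rewrite !F1 ?subrr ?mulr0 //; lra.
Qed.

(* [b] ranges over all integers, not only [0 <= b < (2 ^ m) ^ q], so that the
   induction can replace it by [b - j * (2 ^ m) ^ q] for every branch [j]. *)
Lemma self_similar_flat (R : realType) (m : nat) (P : 'I_(2 ^ m)%N -> R)
    (F : R -> R) (k0 : 'I_(2 ^ m)%N) (q : nat) (b : int) :
  self_similar_cdf P F -> P k0 = 0 ->
  F ((b%:~R * (2 ^ m)%:R + k0%:R + 1) / (2 ^ m)%:R ^+ q.+1) =
  F ((b%:~R * (2 ^ m)%:R + k0%:R) / (2 ^ m)%:R ^+ q.+1).
Proof.
move=> [F0 F1 _ FE] Pk0.
have hM : (2 ^ m)%:R != 0 :> R by rewrite pnatr_eq0 -lt0n expn_gt0.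
move ME : (2 ^ m)%:R => M in FE hM *.
elim: q b => [|q IHq] b.
  rewrite FE [RHS]FE; apply: eq_bigr => j _; rewrite expr1.
  rewrite ![M * _]mulrC !divfK //.
  (* The two arguments of [F] are consecutive integers, where [F] takes equal values unless they are
     0 and 1. That case forces [b = 0] and [j = k0], a branch of weight zero. *)
  have [bj|jb|bj] := ltgtP (b * (2 ^ m)%N%:Z + k0%:Z) j%:Z.
  - have : (b * (2 ^ m)%N%:Z + k0%:Z + 1)%:~R <= j%:R :> R.
      by rewrite -[j%:R]/(j%:Z%:~R) ler_int; lia.
    by rewrite !(intrD, intrM) -!pmulrn ME => ?; rewrite !F0 //; lra.
  - have : (j%:Z + 1)%:~R <= (b * (2 ^ m)%N%:Z + k0%:Z)%:~R :> R.
      by rewrite ler_int; lia.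
    by rewrite !(intrD, intrM) -!pmulrn ME => ?; rewrite !F1 //; lra.
  - have b0 : b = 0 by have := ltn_ord j; have := ltn_ord k0; nia.
    have -> : j = k0 by apply: val_inj => /=; move: bj; rewrite b0; lia.
    by rewrite Pk0 !mul0r.
rewrite FE [RHS]FE; apply: eq_bigr => j _; congr (_ * _).
have := IHq (b - j%:Z * (2 ^ m)%N%:Z ^+ q); rewrite intrB intrM rmorphXn /=.
rewrite -!pmulrn ME => IH; set u := b%:~R in IH *.
set v := k0%:R in IH *; set w := j%:R in IH *.
have -> : M * ((u * M + v + 1) / M ^+ q.+2) - w
  = ((u - w * M ^+ q) * M + v + 1) / M ^+ q.+1.
  by rewrite !exprS; field; rewrite hM expf_neq0.
have -> : M * ((u * M + v) / M ^+ q.+2) - w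
  = ((u - w * M ^+ q) * M + v) / M ^+ q.+1.
  by rewrite !exprS; field; rewrite hM expf_neq0.
exact: IH.
Qed.

(* Prefixing [x] by any [j] binary digits shifts the base-[2 ^ m] blocks of its
   expansion; the word [k0] is appended to the prefix fixing the cell so that
   it becomes aligned with a block after the shift by [j]. *)
Lemma dyadic_sum_flat (R : realType) (m : nat) (P : 'I_(2 ^ m)%N -> R)
    (F : R -> R) (k0 : 'I_(2 ^ m)%N) (j : nat) :
  (0 < m)%N -> self_similar_cdf P F -> P k0 = 0 -> (j <= m)%N ->
  exists n a : nat, (a < 2 ^ n)%N /\ forall i, (i < j)%N ->
    dyadic_sum F i (a%:R / 2 ^+ n) = dyadic_sum F i (a.+1%:R / 2 ^+ n).
Proof.
move=> m0 FP Pk0; have [_ _ Fle _] := FP.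
elim: j => [|j IHj] jm; first by exists 0, 0.
have [n [a [an flat]]] := IHj (ltnW jm).
(* [d] pads with zero bits, so that the new prefix together with [j] further digits fills exactly
   [n + 2] blocks of [m] bits. *)
have [d n'E] : exists d, (n + m + d + j = m * n.+2)%N.
  have le : (n + m + j <= m * n.+2)%N by nia.
  by exists (m * n.+2 - (n + m + j))%N; lia.
(* In binary, [a'] is [a], then [d] zeros, then the [m] bits of [k0]. *)
pose n' := (n + m + d)%N; pose a' := (a * 2 ^ (m + d) + k0)%N.
have k0lt : (k0.+1 <= 2 ^ (m + d))%N.
  by rewrite (leq_trans (ltn_ord k0)) // leq_exp2l // leq_addr.
have n'D : (2 ^ n' = 2 ^ n * 2 ^ (m + d))%N by rewrite -expnD addnA.
exists n', a'; split; first by rewrite n'D /a'; nia.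
have p0 e : (2 : R) ^+ e != 0 by rewrite expf_neq0 // pnatr_eq0.
have pgt e : 0 < (2 : R) ^+ e by rewrite exprn_gt0.
have la : a%:R / 2 ^+ n <= a'%:R / 2 ^+ n' :> R.
  rewrite ler_pdivrMr // mulrAC ler_pdivlMr // -!natrX -!natrM ler_nat n'D /a'.
  by nia.
have ra : a'.+1%:R / 2 ^+ n' <= a.+1%:R / 2 ^+ n :> R.
  rewrite ler_pdivrMr // mulrAC ler_pdivlMr // -!natrX -!natrM ler_nat n'D /a'.
  by nia.
have aa : a'%:R / 2 ^+ n' <= a'.+1%:R / 2 ^+ n' :> R.
  by rewrite ler_pM2r ?invr_gt0 // ler_nat.
move=> i; rewrite ltnS leq_eqVlt => /predU1P[->|ij]; last first.
  (* For earlier indices the new cell lies inside the old one, and a monotone function that is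
     constant at the ends of the old cell is constant between them. *)
  have Ale := @dyadic_sum_homo _ _ i Fle.
  by apply: le_anti; rewrite (Ale _ _ aa) /= (le_trans (Ale _ _ ra)) // -flat // Ale.
apply: eq_bigr => k _; congr (_ - _).
have -> : (a'.+1%:R / 2 ^+ n' + k%:R) / 2 ^+ j =
    (((a * 2 ^ d + k * 2 ^ (n + d))%N%:Z)%:~R * (2 ^ m)%:R + k0%:R + 1)
    / (2 ^ m)%:R ^+ n.+2 :> R.
  rewrite [in RHS]natrX -[in RHS]exprM -n'E -/n' exprD.
  rewrite -pmulrn /a' -natr1 !(natrD, natrM, natrX) /n' !exprD.
  by field; rewrite !p0.
have -> : (a'%:R / 2 ^+ n' + k%:R) / 2 ^+ j =
    (((a * 2 ^ d + k * 2 ^ (n + d))%N%:Z)%:~R * (2 ^ m)%:R + k0%:R)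
    / (2 ^ m)%:R ^+ n.+2 :> R.
  rewrite [in RHS]natrX -[in RHS]exprM -n'E -/n' exprD.
  rewrite -pmulrn /a' !(natrD, natrM, natrX) /n' !exprD.
  by field; rewrite !p0.
by rewrite (self_similar_flat _ _ FP).
Qed.

(** * The self-similar measure and its atoms *)

Lemma le_fine_prob (R : realType) (mu : probability (measurableTypeR R) R)
    (A B : set R) :
  measurable A -> measurable B -> A `<=` B -> fine (mu A) <= fine (mu B).
Proof.
move=> mA mB AB; apply: fine_le; [exact: fin_num_measure..|].
by apply: le_measure => //; rewrite inE.
Qed.

Lemma is_muP_fine (R : realType) (m : nat) (P : 'I_(2 ^ m)%N -> R)
    (mu : probability (measurableTypeR R) R) (B : set (measurableTypeR R)) :
  is_muP P mu -> measurable B -> B `<=` `[0, 1]%classic ->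
  fine (mu B) = \sum_k P k * fine (mu (`[0, 1]%classic `&` fk k @^-1` B)).
Proof.
move=> [_ muE] mB B01; rewrite muE //.
have mf (k : 'I_(2 ^ m)%N) :
    measurable (`[0%R, 1%R] `&` fk k @^-1` B : set (measurableTypeR R)).
  suff : measurable_fun (`[0%R, 1%R] : set (measurableTypeR R)) (@fk R m k).
    by apply.
  by apply: measurable_funM => //; apply: measurable_funD.
rewrite -sum_fine => [|k _].
  by apply: eq_bigr => k _; rewrite fineM // fin_num_measure.
by rewrite fin_numM // fin_num_measure.
Qed.

Lemma is_muP_null (R : realType) (m : nat) (P : 'I_(2 ^ m)%N -> R)
    (mu : probability (measurableTypeR R) R) (B : set (measurableTypeR R)) :
  is_muP P mu -> measurable B -> B `&` `[0, 1]%classic = set0 ->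
  fine (mu B) = 0.
Proof.
move=> [mu01 _] mB B01.
have m01 : measurable (`[0%R, 1%R]%classic : set (measurableTypeR R)) by [].
have muC : mu (~` `[0, 1]%classic) = 0%E by rewrite probability_setC // mu01 subee.
apply/eqP; rewrite eq_le; apply/andP; split; last exact: fine_ge0.
rewrite -[leRHS]/(fine 0%E) -muC; apply: le_fine_prob => //.
  exact: measurableC.
by apply/disjoints_subset.
Qed.

Lemma is_muP_atom (R : realType) (m : nat) (P : 'I_(2 ^ m)%N -> R)
    (mu : probability (measurableTypeR R) R) (x : R) :
  is_muP P mu -> x \in `[0, 1] ->
  fine (mu [set x]) = \sum_k P k * fine (mu [set (2 ^ m)%:R * x - k%:R]).
Proof.
move=> hmu x01; have M0 : (2 ^ m)%:R != 0 :> R by rewrite pnatr_eq0 -lt0n expn_gt0.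
rewrite (is_muP_fine hmu) //; last by move=> _ ->.
apply: eq_bigr => k _; set y := _ - _; congr (_ * _).
have yE : fk k @^-1` [set x] = [set y].
  apply/seteqP; split=> z; rewrite /fk /y /=.
    by move=> <-; rewrite mulrC divfK // addrK.
  by move=> ->; rewrite subrK mulrC mulKf.
(* Outside the unit interval the intersection is empty and the atom at [y] is null, so both sides
   vanish. *)
rewrite yE setIC; have [y01|y01] := boolP (y \in `[0, 1]).
  by rewrite setIidl // => _ ->.
have e0 : [set y] `&` `[0, 1] = set0.
  by apply/seteqP; split=> // z [->] /=; rewrite (negbTE y01).
by rewrite e0 measure0 (is_muP_null hmu).
Qed.

(* The endpoints carry no atom because [P 0, P (2 ^ m - 1) < 1]. Hence at most
   one term of [is_muP_atom] is nonzero, which gives [mu {x} <= q ^+ n] for all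
   [n], with [q < 1] the largest weight. *)
Lemma is_muP_atomless (R : realType) (m : nat) (P : 'I_(2 ^ m)%N -> R)
    (mu : probability (measurableTypeR R) R) (x : R) :
  (0 < m)%N -> in_Pm P -> is_muP P mu -> fine (mu [set x]) = 0.
Proof.
move=> m0 [P01 _] hmu; pose g y := fine (mu [set y]).
have P0 k : 0 <= P k by case/andP: (P01 k).
have P1 k : P k < 1 by case/andP: (P01 k).
have g0 y : 0 <= g y by exact: fine_ge0.
have gout y : y \notin `[0, 1] -> g y = 0.
  move=> y01; apply: (is_muP_null hmu) => //.
  by apply/seteqP; split=> // z [->] /=; rewrite (negbTE y01).
have M1 : (1 < 2 ^ m)%N by rewrite -{1}(expn0 2) ltn_exp2l.
have fixed k y : g y = P k * g y -> g y = 0.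
  move=> gy; have : (1 - P k) * g y = 0 by rewrite mulrBl mul1r -gy subrr.
  by move/eqP; rewrite mulf_eq0 subr_eq0 gt_eqF //= => /eqP.
(* Branch 0 fixes the point 0, while every other branch sends 0 to [- k], outside the support; the
   last branch plays this role for the point 1. *)
have g0E : g 0 = 0.
  apply: (fixed (Ordinal (ltnW M1))).
  rewrite {1}/g (is_muP_atom hmu) ?in_itv /= ?lexx ?ler01 // mulr0.
  rewrite (bigD1 (Ordinal (ltnW M1))) //= subr0 big1 ?addr0 // => k k0.
  rewrite -/(g _) gout ?mulr0 // in_itv /= sub0r oppr_ge0 lern0 negb_and.
  by move: k0; rewrite -val_eqE /= => ->.
have g1E : g 1 = 0.
  have lM : ((2 ^ m).-1 < 2 ^ m)%N by lia.
  apply: (fixed (Ordinal lM)).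
  rewrite {1}/g (is_muP_atom hmu) ?in_itv /= ?lexx ?ler01 // mulr1.
  rewrite (bigD1 (Ordinal lM)) //= big1 ?addr0 => [|k kM].
    by rewrite -[in X in X%:R - _](ltn_predK M1) -natr1 addrAC subrr add0r.
  rewrite -/(g _) gout ?mulr0 // in_itv /= negb_and; apply/orP; right.
  move: kM; rewrite -val_eqE /= => kM; rewrite lerBlDr nat1r ler_nat.
  by have := ltn_ord k; lia.
(* The default value 0 is harmless: the weights are nonnegative, and 0 is below 1. *)
pose q := \big[Order.max/0]_k P k.
have q0 : 0 <= q by exact: (le_trans (P0 (Ordinal M1)) (le_bigmax _ _ _)).
have q1 : q < 1 by apply: bigmax_lt.
have step c : 0 <= c -> (forall y, g y <= c) -> forall y, g y <= q * c.
  move=> c0 gc y; have [y01|y01] := boolP (y \in `[0, 1]); last first.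
    by rewrite gout // mulr_ge0.
  have gin z : g z != 0 -> 0 < z < 1.
    move=> gz; have : z \in `[0, 1] by apply: contraNT gz => /gout ->.
    rewrite in_itv /= !le_eqVlt => /andP[/predU1P[z0|->] /predU1P[z1|->]] //.
    - by rewrite -z0 g0E eqxx in gz.
    - by rewrite -z0 g0E eqxx in gz.
    - by rewrite z1 g1E eqxx in gz.
  rewrite {1}/g (is_muP_atom hmu) //.
  have [/existsP[k gk]|/existsPn gk] :=
      boolP [exists k : 'I_(2 ^ m), g ((2 ^ m)%:R * y - k%:R) != 0]; last first.
    rewrite big1 ?mulr_ge0 // => k _.
    by have := gk k; rewrite negbK => /eqP; rewrite /g => ->; rewrite mulr0.
  rewrite (bigD1 k) //= big1 ?addr0 => [|j jk].
    by apply: ler_pM; [exact: P0|exact: g0|exact: le_bigmax|exact: gc].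
  have [|gj] := eqVneq (g ((2 ^ m)%:R * y - j%:R)) 0.
    by rewrite /g => ->; rewrite mulr0.
  (* Points for distinct branches are at least 1 apart, so they cannot both lie in the open unit
     interval. *)
  have := gin _ gj; have := gin _ gk; case: (ltngtP k j) => [kj|jk'|kj].
  - have : k.+1%:R <= j%:R :> R by rewrite ler_nat.
    by rewrite -natr1 => ? ? ?; lra.
  - have : j.+1%:R <= k%:R :> R by rewrite ler_nat.
    by rewrite -natr1 => ? ? ?; lra.
  - by rewrite -val_eqE /= kj eqxx in jk.
have gq n y : g y <= q ^+ n.
  elim: n y => [|n IHn] y; last by rewrite exprS; apply: step => //; exact: exprn_ge0.
  have : fine (mu [set y]) <= fine (mu setT) by exact: le_fine_prob.
  by rewrite probability_setT.
apply/eqP; rewrite eq_le g0 andbT.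
have /cvg_expr qn0 : `|q| < 1 by rewrite ger0_norm.
by apply: (cvgr_to_ge qn0); apply: nearW => n; exact: gq.
Qed.

(** * The distribution function of the measure *)

Lemma Phi_self_similar (R : realType) (m : nat) (P : 'I_(2 ^ m)%N -> R)
    (mu : probability (measurableTypeR R) R) :
  (0 < m)%N -> in_Pm P -> is_muP P mu -> self_similar_cdf P (Phi mu).
Proof.
move=> m0 hP hmu; have [mu01 _] := hmu; have [_ sumP] := hP.
have F0 x : x <= 0 -> Phi mu x = 0.
  rewrite le_eqVlt /Phi => /predU1P[->|x0].
    by rewrite set_itv1 (is_muP_atomless _ m0 hP hmu).
  by rewrite set_itv_ge ?measure0 // bnd_simp -ltNge.
have Fle : {homo Phi mu : x y / x <= y}.
  move=> x y xy; apply: le_fine_prob => // z /=.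
  by rewrite !in_itv /= => /andP[-> zx]; exact: le_trans xy.
have F1 x : 1 <= x -> Phi mu x = 1.
  move=> x1; apply/eqP; rewrite eq_le; apply/andP; split.
    have -> : 1 = fine (mu setT) by rewrite probability_setT.
    exact: le_fine_prob.
  have -> : 1 = Phi mu 1 by rewrite /Phi mu01.
  exact: Fle.
have M0 : 0 < (2 ^ m)%:R :> R by rewrite ltr0n expn_gt0.
split=> // x.
have [x0|x0] := leP x 0.
  rewrite F0 // big1 // => k _; rewrite F0 ?mulr0 // subr_le0.
  by apply: (@le_trans _ _ 0) => //; rewrite pmulr_rle0.
have [x1|x1] := leP 1 x.
  rewrite F1 // -[LHS]sumP; apply: eq_bigr => k _; rewrite F1 ?mulr1 //.
  have : k.+1%:R <= (2 ^ m)%:R * x.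
    rewrite (@le_trans _ _ (2 ^ m)%:R) ?ler_nat // -[leLHS]mulr1.
    by rewrite ler_pM2l.
  by rewrite -natr1; lra.
rewrite [LHS](is_muP_fine hmu) //; last first.
  by move=> z /=; rewrite !in_itv /= => /andP[-> /le_trans]; apply; exact: ltW.
apply: eq_bigr => k _; congr (_ * _).
(* The cap at 1 disappears afterwards because [Phi] is constant from 1 on; a negative bound gives
   the empty interval. *)
have -> : `[0, 1] `&` fk k @^-1` `[0, x] =
    `[0, Num.min 1 ((2 ^ m)%:R * x - k%:R)]%classic.
  apply/seteqP; split=> z; rewrite /= /fk !in_itv /= le_min.
    move=> [/andP[-> ->]] /andP[_]; rewrite ler_pdivrMr // mulrC.
    by rewrite -lerBrDr.
  move=> /andP[z0 /andP[z1 zx]]; rewrite z0 z1; split=> //.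
  by rewrite divr_ge0 ?addr_ge0 //= ler_pdivrMr // mulrC -lerBrDr.
by rewrite -/(Phi mu _) minEle; case: leP => // ?; rewrite !F1.
Qed.

(** Closed intervals shrinking to [x] have measures tending to that of the atom at [x], which is
    zero, and these measures bound the increments of [Phi] near [x]. *)
Lemma continuous_Phi (R : realType) (mu : probability (measurableTypeR R) R) :
  (forall x, fine (mu [set x]) = 0) -> continuous (Phi mu).
Proof.
move=> atomless; change (forall x : R, {for x, continuous (Phi mu)}) => x.
pose S n : set (measurableTypeR R) := `[x - n.+1%:R^-1, x + n.+1%:R^-1]%classic.
have mS n : measurable (S n) by exact: measurable_itv.
have capS : \bigcap_n S n = [set x].
  apply/seteqP; split=> [y Sy|_ -> n _] /=; last first.
    by rewrite /S /= in_itv /= gerBl lerDl invr_ge0 ler0n.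
  apply/eqP; rewrite eq_sym -subr_eq0 -normr_le0 leNgt; apply/negP => xy.
  have [n _ /(_ n (leqnn n)) /= nxy] := near_infty_natSinv_lt (PosNum xy).
  have := Sy n I; rewrite /S /= in_itv /= -ler_distl distrC => /(lt_le_trans nxy).
  by rewrite ltxx.
have muS : fine (mu (S n)) @[n --> \oo] --> 0.
  apply: fine_cvg; rewrite -(atomless x) fineK ?fin_num_measure // -capS.
  apply: nonincreasing_cvg_mu => //.
  - by rewrite (le_lt_trans (probability_le1 mu _)) // ltry.
  - by rewrite capS.
  - move=> n k nk; apply/subsetPset => y; rewrite /S /= !in_itv /=.
    have : k.+1%:R^-1 <= n.+1%:R^-1 :> R by rewrite lef_pV2 ?posrE ?ler_nat.
    move=> kn /andP[xy yx]; apply/andP; split.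
      by apply: le_trans xy; rewrite lerD2l lerN2.
    by apply: (le_trans yx); rewrite lerD2l.
have incr a b c d : c <= a -> a <= b -> b <= d ->
    `|Phi mu b - Phi mu a| <= fine (mu `[c, d]%classic).
  move=> ca ab bd; have m1 (u v : R) : measurable (`[u, v]%classic : set (measurableTypeR R)).
    by [].
  rewrite ger0_norm; last first.
    rewrite subr_ge0; apply: le_fine_prob => // z /=.
    by rewrite !in_itv /= => /andP[-> /le_trans->].
  rewrite lerBlDl /Phi -fineD ?fin_num_measure //.
  apply: fine_le; rewrite ?fin_numD ?fin_num_measure //.
  (* Subadditivity suffices, since [[0, b]] is covered by [[0, a]] and [[c, d]]. *)
  rewrite (le_trans _ (measureU2 mu (m1 _ _) (m1 _ _))) //.
  apply: le_measure; rewrite ?inE //; first exact: measurableU.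
  move=> z /=; rewrite !in_itv /= => /andP[z0 zb].
  by have [za|az] := leP z a; [left; rewrite z0|right; lra].
apply/cvgrPdist_lt => e e0.
have /cvgrPdist_lt/(_ e e0)[n _ /(_ n (leqnn n)) /=] := muS.
rewrite sub0r normrN => /(le_lt_trans (ler_norm _)) Sn.
have n0 : 0 < n.+1%:R^-1 :> R by rewrite invr_gt0.
near=> y; apply: le_lt_trans Sn.
have : `|x - y| < n.+1%:R^-1 by near: y; exact: (@cvgr_dist_lt _ _ _ _ _ id).
rewrite ltr_distlC => /andP[xy yx].
by have [h|/ltW h] := leP x y; [rewrite distrC|]; apply: incr;
  rewrite ?gerBl ?lerDl ?(ltW n0) ?(ltW xy) ?(ltW yx).
Unshelve. all: by end_near.
Qed.

Theorem theorem3p3 (R : realType) (m : nat) (hm : (2 <= m)%N)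
    (P : 'I_(2 ^ m)%N -> R) (hP : in_Pm P)
    (mu : probability (measurableTypeR R) R) (hmu : is_muP P mu) :
  MW_solution (varphi m mu) /\
  (KP P <> [set: 'I_(2 ^ m)%N] ->
    ~ {in `[0, 1] &, {homo varphi m mu : x y / x < y}}).
Proof.
have m0 : (0 < m)%N by exact: ltnW.
have FP := Phi_self_similar m0 hP hmu; have [F0 F1 Fle _] := FP.
have cF : continuous (Phi mu).
  by apply: continuous_Phi => x; exact: (is_muP_atomless _ m0 hP hmu).
have phiE x : varphi m mu x = m%:R^-1 * \sum_(i < m) dyadic_sum (Phi mu) i x by [].
have mR0 : m%:R != 0 :> R by rewrite pnatr_eq0 -lt0n.
have phi_le : {homo varphi m mu : x y / x <= y}.
  move=> x y xy; rewrite !phiE ler_wpM2l ?invr_ge0 //.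
  by apply: ler_sum => i _; exact: dyadic_sum_homo.
have phi0 : varphi m mu 0 = 0.
  by rewrite phiE big1 ?mulr0 // => i _; rewrite dyadic_sum_at0.
have phi1 : varphi m mu 1 = 1.
  rewrite phiE (eq_bigr (fun=> 1)) => [|i _].
    by rewrite sumr_const card_ord mulVf.
  by rewrite dyadic_sum_at1 F1 // F0 // subr0.
split.
  split; split => //.
  - move=> x; rewrite !in_itv /= => /andP[x0 x1].
    by rewrite -{1}phi0 -phi1 !phi_le.
  - by move=> x y _ _; exact: phi_le.
  - apply: continuous_subspaceT => x; apply: cvgMl_tmp.
    apply: continuous_big => [|i _]; first exact: add_continuous.
    exact: continuous_dyadic_sum.
  - move=> x x01; rewrite !phiE -mulrDr -mulrBr; congr (_ * _).
    rewrite -big_split -sumrB /=.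
    under [RHS]eq_bigr do rewrite -dyadic_sumS.
    (* The two sums differ only in the first term on the left, of index 0, and the last on the
       right, of index [m]; both equal [Phi mu x]. *)
    rewrite -(prednK m0) big_ord_recl big_ord_recr /= prednK //.
    by rewrite (dyadic_sum_period FP x01) (dyadic_sum0 _ (F0 0 (lexx 0))) addrC.
move=> KPT; have [k0 Pk0] : exists k0, P k0 = 0.
  apply: contrapT => nP; apply: KPT; apply/seteqP; split=> // k _ /=.
  by apply/eqP => Pk; apply: nP; exists k.
(* With [j = m], a single cell serves all the indices averaged in [varphi]. *)
have [n [a [an flat]]] := dyadic_sum_flat m0 FP Pk0 (leqnn m).
have n0 : 0 < (2 : R) ^+ n by rewrite exprn_gt0.
move=> /(_ (a%:R / 2 ^+ n) (a.+1%:R / 2 ^+ n)).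
have -> : varphi m mu (a%:R / 2 ^+ n) = varphi m mu (a.+1%:R / 2 ^+ n).
  by rewrite !phiE; congr (_ * _); apply: eq_bigr => i _; exact: flat.
rewrite ltxx ltr_pM2r ?invr_gt0 // ltr_nat ltnSn => incr; apply/notF/incr => //.
  rewrite in_itv /= divr_ge0 ?(ltW n0) //= ler_pdivrMr // mul1r -natrX ler_nat.
  exact: ltnW.
by rewrite in_itv /= divr_ge0 ?(ltW n0) //= ler_pdivrMr // mul1r -natrX ler_nat.
Qed.
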